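(* Let $x$ be a real number with $0<|x|\le 1$. For all even integers $n\geq 0$ we have $$\sum_{k=0}^\infty\frac{\binom{2k}{k}}{2k+n+1}\Bigl(\frac{x}{2}\Bigr)^{2k} =\frac{\binom{n}{n/2}}{(2x)^{n+1}}\left(2\arcsin x-\sqrt{1-x^2}\cdot\sum_{j=0}^{\frac{n-2}{2}}\frac{(2x)^{2j+1}}{(2j+1)\binom{2j}{j}}\right),$$ and for all odd integers $n\geq 1$, $$\sum_{k=0}^\infty\frac{\binom{2k}{k}}{2k+n+1}\Bigl(\frac{x}{2}\Bigr)^{2k} =\frac{\bigl(\frac{2}{x}\bigr)^{n+1}}{(n+1)\binom{n+1}{\frac{n+1}{2}}} \left(1-\sqrt{1-x^2}\cdot\sum_{j=0}^{\frac{n-1}{2}}\binom{2j}{j}\Bigl(\frac{x}{2}\Bigr)^{2j}\right).$$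
   Context: Empty sums (e.g. $\sum_{j=0}^{-1}$) are equal to $0$. Here $\arcsin$ is the principal real arcsine on $[-1,1]$. *)

(* Defs.v *)
From Stdlib Require Import Reals Arith.
From Coquelicot Require Import Coquelicot.

Open Scope R_scope.

(** Coquelicot reuses the name [C] for the complex numbers. *)
Notation binom := Binomial.C (only parsing).

(** [a 0 + ... + a (m - 1)], equal to [0] when [m = 0]; Coquelicot's
    [sum_n a p] is the sum up to and including [a p]. *)
Definition sum_below (a : nat -> R) (m : nat) : R :=
  match m with
  | O => 0
  | S p => sum_n a p
  end.

(* Main.v *)
(** Up to the factor [x^(n + 1)], the series is the expansion of
    [I_n = int_0^x t^n / sqrt (1 - t^2) dt].  For [n = 0, 1], substitute
    [x = sin t]: the error of the [N]-th partial sum has derivative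
    [sin t ^ n * (1 - cos t * P_N (sin t))], where [P_N] is the Taylor polynomial
    of [1 / sqrt (1 - s^2)].  The last factor lies in [[0, 1]], and tends to [0]
    uniformly away from [PI / 2], because its own derivative is the single term
    [(2 N + 1) a_N sin t ^ (2 N + 1)]; hence the error tends to [0], the endpoint
    [x = 1] included.  Termwise, the series satisfy the reduction formula
    [(n + 2) I_(n + 2) = (n + 1) I_n - x^(n + 1) sqrt (1 - x^2)], as do the closed
    forms. *)

Require Import Defs.
From Stdlib Require Import Reals Arith Lra Lia.
From Coquelicot Require Import Coquelicot.

Open Scope R_scope.

(** * Bounds from derivatives, and an elementary limit *)

Lemma derive_nonneg_le (f df : R -> R) (a b : R) :
  a <= b ->
  (forall t, a <= t <= b -> is_derive f t (df t)) ->
  (forall t, a <= t <= b -> 0 <= df t) -> f a <= f b.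
Proof.
  intros Hab Hd Hp.
  destruct (MVT_gen f a b df) as [c [Hc Heq]];
    rewrite ?Rmin_left, ?Rmax_right in * by assumption.
  - intros t Ht; apply Hd; lra.
  - intros t Ht; apply derivable_continuous_pt.
    exists (df t); apply is_derive_Reals, Hd; lra.
  - assert (0 <= df c * (b - a)) by (apply Rmult_le_pos; [apply Hp, Hc | lra]).
    lra.
Qed.

Lemma derive_le_sub_le (f df : R -> R) (a b M : R) :
  a <= b ->
  (forall t, a <= t <= b -> is_derive f t (df t)) ->
  (forall t, a <= t <= b -> df t <= M) -> f b - f a <= M * (b - a).
Proof.
  intros Hab Hd Hp.
  assert (M * a - f a <= M * b - f b); [| lra].
  apply (derive_nonneg_le (fun t => M * t - f t) (fun t => M - df t)); auto.
  - intros t Ht.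
    apply (is_derive_minus (fun t => M * t) f t M (df t)); [| now apply Hd].
    auto_derive; [easy | ring].
  - intros t Ht; specialize (Hp t Ht); lra.
Qed.

Lemma is_lim_seq_INR_mul_pow (q : R) :
  0 <= q < 1 -> is_lim_seq (fun n => INR n * q ^ n) 0.
Proof.
  intros Hq.
  set (r := sqrt q).
  assert (Hr : 0 <= r < 1).
  { split; [apply sqrt_pos |].
    rewrite <- sqrt_1; apply sqrt_lt_1; lra. }
  assert (Hrq : q = r * r) by (symmetry; apply sqrt_sqrt; lra).
  assert (Hp : forall n, 0 <= r ^ n) by (intros n; apply pow_le, Hr).
  (* Bernoulli: [n r^n] is bounded, and [q^n = r^n r^n]. *)
  assert (Hb : forall n, r ^ n * (1 + INR n * (1 - r)) <= 1).
  { induction n as [|n IH]; [simpl; lra |].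
    apply Rle_trans with (2 := IH).
    rewrite S_INR; simpl.
    replace (r * r ^ n * (1 + (INR n + 1) * (1 - r)))
      with (r ^ n * (1 + INR n * (1 - r) - (INR n + 1) * (1 - r) ^ 2)) by ring.
    apply Rmult_le_compat_l; [apply Hp |].
    assert (0 <= (INR n + 1) * (1 - r) ^ 2); [| lra].
    apply Rmult_le_pos; [pose proof (pos_INR n); lra | apply pow2_ge_0]. }
  apply is_lim_seq_le_le with (fun _ => 0) (fun n => / (1 - r) * r ^ n).
  - intros n; split.
    + apply Rmult_le_pos; [apply pos_INR | apply pow_le, Hq].
    + rewrite Hrq, Rpow_mult_distr, <- Rmult_assoc.
      apply Rmult_le_compat_r; [apply Hp |].
      apply Rmult_le_reg_r with (1 - r); [lra |].
      rewrite Rinv_l by lra.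
      specialize (Hb n); specialize (Hp n); lra.
  - apply is_lim_seq_const.
  - replace (Finite 0) with (Rbar_mult (/ (1 - r)) 0)
      by (simpl; f_equal; ring).
    apply is_lim_seq_scal_l, is_lim_seq_geom.
    rewrite Rabs_pos_eq; lra.
Qed.

(** * Central binomial coefficients *)

Lemma central_binom_pos (k : nat) : 0 < binom (2 * k) k.
Proof.
  unfold Binomial.C.
  apply Rdiv_lt_0_compat; [| apply Rmult_lt_0_compat]; apply INR_fact_lt_0.
Qed.

Lemma central_binom_S (k : nat) :
  binom (2 * S k) (S k) = 2 * (2 * INR k + 1) / (INR k + 1) * binom (2 * k) k.
Proof.
  unfold Binomial.C.
  replace (2 * S k - S k)%nat with (S k) by lia.
  replace (2 * k - k)%nat with k by lia.
  replace (2 * S k)%nat with (S (S (2 * k))) by lia.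
  rewrite !fact_simpl, !mult_INR, !S_INR, mult_INR.
  pose proof (INR_fact_neq_0 k); pose proof (pos_INR k).
  replace (INR 2) with 2 by reflexivity.
  field; split; [assumption | lra].
Qed.

Lemma Rpow_div_distr (u v : R) (n : nat) : (u / v) ^ n = u ^ n / v ^ n.
Proof. unfold Rdiv; now rewrite Rpow_mult_distr, pow_inv. Qed.

Lemma sum_n_RS (a : nat -> R) (m : nat) : sum_n a (S m) = sum_n a m + a (S m).
Proof. exact (sum_Sn (G := R_AbelianMonoid) a m). Qed.

(** * Partial sums of [1 / sqrt (1 - s^2)] and their integrals *)

(** The coefficient of [s^(2k)] in [1 / sqrt (1 - s^2)]; [4^k] absorbs the denominator of
    [(x / 2)^(2k)]. *)
Definition invsqrt_coef (k : nat) : R := binom (2 * k) k / 4 ^ k.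

Lemma invsqrt_coef_0 : invsqrt_coef 0 = 1.
Proof. unfold invsqrt_coef, Binomial.C; simpl; field. Qed.

Lemma invsqrt_coef_pos (k : nat) : 0 < invsqrt_coef k.
Proof.
  apply Rdiv_lt_0_compat; [apply central_binom_pos | apply pow_lt; lra].
Qed.

Lemma invsqrt_coef_S (k : nat) :
  invsqrt_coef (S k) = (2 * INR k + 1) / (2 * INR k + 2) * invsqrt_coef k.
Proof.
  unfold invsqrt_coef; rewrite central_binom_S; simpl pow.
  assert (4 ^ k <> 0) by (apply pow_nonzero; lra).
  pose proof (pos_INR k).
  field; repeat split; lra.
Qed.

(** Consecutive ratios are below 1. This crude bound suffices, since the coefficient later stands
    beside [(2 N + 1) q^(2 N + 1)] with [q < 1]. *)
Lemma invsqrt_coef_le_1 (k : nat) : invsqrt_coef k <= 1.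
Proof.
  induction k as [|k IH]; [rewrite invsqrt_coef_0; lra |].
  rewrite invsqrt_coef_S.
  pose proof (pos_INR k); pose proof (invsqrt_coef_pos k).
  assert ((2 * INR k + 1) / (2 * INR k + 2) <= 1)
    by (apply Rle_div_l; lra).
  apply Rle_trans with (1 * invsqrt_coef k); [| lra].
  apply Rmult_le_compat_r; lra.
Qed.

Definition invsqrt_sum (N : nat) (s : R) : R :=
  sum_n (fun k => invsqrt_coef k * s ^ (2 * k)) N.

Lemma invsqrt_sum_nonneg (N : nat) (s : R) : 0 <= invsqrt_sum N s.
Proof.
  induction N as [|N IH]; unfold invsqrt_sum in *.
  - rewrite sum_O, invsqrt_coef_0; simpl; lra.
  - rewrite sum_Sn; apply Rplus_le_le_0_compat; [exact IH |].
    apply Rmult_le_pos; [apply Rlt_le, invsqrt_coef_pos |].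
    rewrite pow_mult; apply pow_le, pow2_ge_0.
Qed.

(* The recurrence for the coefficients makes this derivative telescope. *)
Lemma is_derive_invsqrt_defect (N : nat) (t : R) :
  is_derive (fun t => 1 - cos t * invsqrt_sum N (sin t)) t
    ((2 * INR N + 1) * invsqrt_coef N * sin t ^ (2 * N + 1)).
Proof.
  induction N as [|N IH].
  - apply is_derive_ext with (fun t => 1 - cos t).
    { intros u; unfold invsqrt_sum; rewrite sum_O, invsqrt_coef_0; simpl; ring. }
    auto_derive; [easy |]; rewrite invsqrt_coef_0; simpl; ring.
  - apply is_derive_ext with
      (fun t => minus (1 - cos t * invsqrt_sum N (sin t))
                  (invsqrt_coef (S N) * (cos t * sin t ^ (2 * S N)))).
    { intros u; unfold invsqrt_sum; rewrite sum_Sn.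
      unfold minus, plus, opp; simpl; ring. }
    replace ((2 * INR (S N) + 1) * invsqrt_coef (S N) * sin t ^ (2 * S N + 1)) with
      (minus ((2 * INR N + 1) * invsqrt_coef N * sin t ^ (2 * N + 1))
         (invsqrt_coef (S N) * (INR (2 * S N) * sin t ^ (2 * N + 1) * (cos t) ^ 2
                         - sin t ^ (2 * S N + 1)))).
    + apply (is_derive_minus (V := R_NormedModule)); [exact IH |].
      auto_derive; [easy |].
      replace (Init.Nat.pred (2 * S N)) with (2 * N + 1)%nat by lia.
      replace (N + S (N + 0))%nat with (2 * N + 1)%nat by lia.
      change (match (2 * N + 1)%nat with 0%nat => 1 | S _ => INR (2 * N + 1) + 1 end)
        with (INR (S (2 * N + 1))).
      replace (2 * S N)%nat with (S (2 * N + 1)) by lia.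
      generalize (2 * N + 1)%nat as p; intros p.
      rewrite pow_add; simpl pow; ring.
    (* Writing [a_k] for [invsqrt_coef k], the coefficient of [sin t ^ (2 N + 1)] is now
       [(2 N + 1) a_N - (2 N + 2) a_(N+1) = 0]; that of [sin t ^ (2 N + 3)] is
       [(2 N + 2) a_(N+1) + a_(N+1)]. *)
    + replace (cos t ^ 2) with (1 - sin t ^ 2)
        by (pose proof (sin2_cos2 t); unfold Rsqr in *; nra).
      replace (2 * S N + 1)%nat with (2 * N + 1 + 2)%nat by lia.
      rewrite (pow_add _ (2 * N + 1) 2), invsqrt_coef_S, mult_INR, !S_INR.
      pose proof (pos_INR N).
      unfold minus, plus, opp; simpl.
      field; lra.
Qed.

(** The factor [cos t] comes from substituting [sin t]; it compensates the singularity of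
    [1 / sqrt (1 - s^2)] at [s = 1]. *)
Lemma is_derive_integrated_sum (m N : nat) (t : R) :
  is_derive
    (fun t => sum_n (fun k => invsqrt_coef k * sin t ^ (2 * k + m + 1)
                              / INR (2 * k + m + 1)) N) t
    (sin t ^ m * (cos t * invsqrt_sum N (sin t))).
Proof.
  replace (sin t ^ m * (cos t * invsqrt_sum N (sin t))) with
    (sum_n (fun k => invsqrt_coef k * sin t ^ (2 * k + m) * cos t) N).
  - apply (is_derive_sum_n (K := R_AbsRing) (V := R_NormedModule)
             (fun k t => invsqrt_coef k * sin t ^ (2 * k + m + 1) / INR (2 * k + m + 1))).
    intros k _.
    assert (INR (2 * k + m + 1) <> 0) by (apply not_0_INR; lia).
    auto_derive; [easy |].
    replace (Init.Nat.pred (k + (k + 0) + m + 1)) with (2 * k + m)%nat by lia.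
    replace (k + (k + 0) + m + 1)%nat with (2 * k + m + 1)%nat by lia.
    field; assumption.
  - unfold invsqrt_sum.
    rewrite <- Rmult_assoc.
    rewrite <- (sum_n_mult_l (K := R_Ring) (sin t ^ m * cos t)).
    apply sum_n_ext; intros k; rewrite pow_add; unfold mult; simpl; ring.
Qed.

(** * Error estimates and convergence on [[0, PI / 2]] *)

Lemma sin_between (t : R) : 0 <= t <= PI / 2 -> 0 <= sin t <= 1.
Proof.
  intros Ht; split; [apply sin_ge_0; lra | apply SIN_bound].
Qed.

(** The defect vanishes at 0 and has a nonnegative derivative, hence is nonnegative; it is at most 1
    because [cos] and the partial sum are nonnegative. For the last bound, [sin] increases on
    [[0, t]], so the derivative there is at most [(2 N + 1) sin t ^ (2 N + 1)]. *)
Lemma invsqrt_defect_bounds (N : nat) (t : R) :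
  0 <= t <= PI / 2 ->
  0 <= 1 - cos t * invsqrt_sum N (sin t) <= 1 /\
  1 - cos t * invsqrt_sum N (sin t)
    <= (2 * INR N + 1) * sin t ^ (2 * N + 1) * t.
Proof.
  intros Ht.
  set (h := fun t => 1 - cos t * invsqrt_sum N (sin t)).
  set (dh := fun t => (2 * INR N + 1) * invsqrt_coef N * sin t ^ (2 * N + 1)).
  assert (Hh0 : h 0 = 0).
  { unfold h; rewrite cos_0, sin_0.
    assert (invsqrt_sum N 0 = 1); [| lra].
    induction N as [|N IH]; unfold invsqrt_sum in *.
    - rewrite sum_O, invsqrt_coef_0; simpl; ring.
    - rewrite sum_Sn, IH, pow_i by lia; unfold plus; simpl; ring. }
  assert (Hd : forall u, 0 <= u <= t -> is_derive h u (dh u))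
    by (intros; apply is_derive_invsqrt_defect).
  pose proof (pos_INR N); pose proof (invsqrt_coef_pos N); pose proof (invsqrt_coef_le_1 N).
  fold (h t); split; [split |].
  - rewrite <- Hh0; apply (derive_nonneg_le h dh); [lra | exact Hd |].
    intros u Hu; unfold dh.
    apply Rmult_le_pos; [apply Rmult_le_pos; lra |].
    apply pow_le, sin_between; lra.
  - assert (0 <= cos t * invsqrt_sum N (sin t)); [| unfold h; lra].
    apply Rmult_le_pos; [apply cos_ge_0; lra | apply invsqrt_sum_nonneg].
  - replace (h t) with (h t - h 0) by lra.
    rewrite <- (Rminus_0_r t) at 3.
    apply (derive_le_sub_le h dh); [lra | exact Hd |].
    intros u Hu; unfold dh.
    rewrite Rmult_assoc.
    apply Rmult_le_compat_l; [lra |].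
    assert (0 <= sin u <= sin t).
    { split; [apply sin_between; lra | apply sin_incr_1; lra]. }
    pose proof (pow_le (sin u) (2 * N + 1)).
    pose proof (pow_incr (sin u) (sin t) (2 * N + 1)).
    nra.
Qed.

(** [G] is the primitive of [sin ^ m] vanishing at 0, and the error [e N] also vanishes there. Its
    growth is small up to [b] because the defect is, and small beyond [b] because the remaining
    interval is short. *)
Lemma is_series_sin (m : nat) (G : R -> R) :
  G 0 = 0 -> (forall t, is_derive G t (sin t ^ m)) ->
  forall t, 0 <= t <= PI / 2 ->
  is_series (fun k => invsqrt_coef k * sin t ^ (2 * k + m + 1) / INR (2 * k + m + 1))
    (G t).
Proof.
  intros HG0 HG t Ht.
  set (F := fun N t => sum_n (fun k => invsqrt_coef k * sin t ^ (2 * k + m + 1)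
                                       / INR (2 * k + m + 1)) N).
  set (e := fun N t => G t - F N t).
  set (de := fun N t => sin t ^ m * (1 - cos t * invsqrt_sum N (sin t))).
  assert (He0 : forall N, e N 0 = 0).
  { intros N; unfold e; rewrite HG0; unfold F.
    assert (Hz : forall n, sum_n (fun k => invsqrt_coef k * sin 0 ^ (2 * k + m + 1)
                                / INR (2 * k + m + 1)) n = 0); [| rewrite Hz; lra].
    induction n as [|n IH]; rewrite ?sum_O, ?sum_Sn, ?IH, sin_0, pow_i by lia;
      unfold plus, Rdiv; simpl; ring. }
  assert (Hde : forall N u, is_derive (e N) u (de N u)).
  { intros N u; unfold de.
    rewrite Rmult_minus_distr_l, Rmult_1_r.
    apply (is_derive_minus (V := R_NormedModule)); [apply HG |].
    apply is_derive_integrated_sum. }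
  assert (Hpow : forall u, 0 <= u <= PI / 2 -> 0 <= sin u ^ m <= 1).
  { intros u Hu; pose proof (sin_between u Hu); split; [now apply pow_le; lra |].
    rewrite <- (pow1 m); apply pow_incr; lra. }
  (* [3 / 2 < PI / 2] keeps [b = PI / 2 - d] positive when [d <= 1]; [PI / 2 <= 2] bounds all
     lengths by 2. *)
  pose proof PI_4; pose proof PI2_3_2.
  change (is_lim_seq (fun N => F N t) (G t)).
  apply is_lim_seq_spec; intros eps.
  (* Near [PI / 2] only the trivial bound [de <= 1] is uniform in [N]. *)
  set (d := Rmin 1 (eps / 2)).
  assert (Hd : 0 < d <= 1 /\ d <= eps / 2).
  { pose proof (cond_pos eps); unfold d.
    pose proof (Rmin_l 1 (eps / 2)); pose proof (Rmin_r 1 (eps / 2)).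
    repeat split; auto; apply Rmin_glb_lt; lra. }
  set (b := PI / 2 - d).
  set (q := sin b).
  assert (Hq : 0 <= q < 1).
  { split; [apply sin_between; unfold b; lra |].
    rewrite <- sin_PI2; apply sin_increasing_1; unfold b; lra. }
  assert (Hlim : is_lim_seq (fun N => INR (2 * N + 1) * q ^ (2 * N + 1)) 0).
  { apply (is_lim_seq_subseq (fun n => INR n * q ^ n) 0 (fun N => (2 * N + 1)%nat)).
    - apply eventually_subseq; intros n; lia.
    - now apply is_lim_seq_INR_mul_pow. }
  apply is_lim_seq_spec in Hlim.
  (* Chosen so that the final bound [4 * K + d] stays below [eps / 4 + eps / 2]. *)
  assert (Heps : 0 < eps / 16) by (pose proof (cond_pos eps); lra).
  destruct (Hlim (mkposreal _ Heps)) as [N0 HN0].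
  exists N0; intros N HN.
  specialize (HN0 N HN); simpl in HN0.
  replace (N + (N + 0) + 1)%nat with (2 * N + 1)%nat in HN0 by lia.
  set (K := INR (2 * N + 1) * q ^ (2 * N + 1)) in *.
  assert (HK : 0 <= K < eps / 16).
  { assert (0 <= K)
      by (apply Rmult_le_pos; [apply pos_INR | apply pow_le, Hq]).
    split; [assumption |].
    rewrite Rminus_0_r, Rabs_pos_eq in HN0; assumption. }
  assert (Hnn : 0 <= e N t).
  { rewrite <- (He0 N); apply (derive_nonneg_le _ (de N)); [lra | auto |].
    intros u Hu; apply Rmult_le_pos; [apply Hpow; lra |].
    apply invsqrt_defect_bounds; lra. }
  assert (Hb : e N t <= 4 * K + d).
  { set (c := Rmin t b).
    assert (Hc : 0 <= c <= t /\ c <= b /\ t - c <= d).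
    { unfold c, Rmin; destruct (Rle_dec t b); unfold b in *; lra. }
    (* On [[0, c]] we have [sin u <= q] and [u <= 2], so the defect is at most [2 * K]; the length
       [c <= 2] then gives [4 * K]. *)
    assert (H1 : e N c - e N 0 <= 2 * K * (c - 0)).
    { apply (derive_le_sub_le _ (de N)); [lra | auto |].
      intros u Hu; unfold de.
      assert (Hu' : 0 <= u <= PI / 2) by lra.
      destruct (invsqrt_defect_bounds N u Hu') as [Hb1 Hb2].
      pose proof (Hpow u Hu').
      assert ((2 * INR N + 1) * sin u ^ (2 * N + 1) * u <= K * 2).
      { apply Rmult_le_compat; try lra.
        - apply Rmult_le_pos; [pose proof (pos_INR N); lra |].
          apply pow_le, sin_between, Hu'.
        - unfold K; rewrite plus_INR, mult_INR; simpl (INR 2); simpl (INR 1).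
          apply Rmult_le_compat_l; [pose proof (pos_INR N); lra |].
          apply pow_incr; split; [apply sin_between, Hu' |].
          apply sin_incr_1; unfold b in *; lra. }
      nra. }
    assert (H2 : e N t - e N c <= 1 * (t - c)).
    { apply (derive_le_sub_le _ (de N)); [lra | auto |].
      intros u Hu; unfold de.
      assert (Hu' : 0 <= u <= PI / 2) by lra.
      destruct (invsqrt_defect_bounds N u Hu') as [Hb1 _].
      pose proof (Hpow u Hu').
      nra. }
    rewrite He0 in H1.
    assert (2 * K * (c - 0) <= 2 * K * 2) by (apply Rmult_le_compat_l; lra).
    lra. }
  replace (F N t - G t) with (- e N t) by (unfold e; ring).
  rewrite Rabs_Ropp, Rabs_pos_eq; lra.
Qed.

(** * The series for [n = 0] and [n = 1] *)

(** The stated summand multiplied by [x^(n + 1)]: the termwise integral of [t^n / sqrt (1 - t^2)]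
    over [[0, x]]. *)
Definition term (x : R) (n k : nat) : R :=
  invsqrt_coef k * x ^ (2 * k + n + 1) / INR (2 * k + n + 1).

(** All exponents [2 k + n + 1] share the parity of [n + 1]. This carries results from [[0, 1]] to
    [[-1, 1]]. *)
Lemma term_opp (x : R) (n k : nat) : term (- x) n k = (-1) ^ (n + 1) * term x n k.
Proof.
  unfold term.
  replace (- x) with (-1 * x) by ring.
  rewrite Rpow_mult_distr, <- Nat.add_assoc, (pow_add (-1)), pow_mult.
  replace ((-1) ^ 2) with 1 by ring.
  rewrite pow1; unfold Rdiv; ring.
Qed.

Lemma is_series_Rmult_l (c : R) (a : nat -> R) (l : R) :
  is_series a l -> is_series (fun k => c * a k) (c * l).
Proof. exact (is_series_scal_l (K := R_AbsRing) (V := R_NormedModule) c a l). Qed.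

Lemma asin_between (y : R) : 0 <= y <= 1 -> 0 <= asin y <= PI / 2.
Proof.
  intros Hy; pose proof (asin_bound y); pose proof PI2_RGT_0.
  destruct (Rle_lt_dec 0 (asin y)) as [H1 | H1]; [lra |].
  assert (sin (asin y) < sin 0) by (apply sin_increasing_1; lra).
  rewrite sin_asin, sin_0 in *; lra.
Qed.

Lemma is_series_Rext (a b : nat -> R) (l : R) :
  (forall k, a k = b k) -> is_series a l -> is_series b l.
Proof. exact (is_series_ext (V := R_NormedModule) a b l). Qed.

Lemma is_series_eq_lim (a : nat -> R) (l l' : R) :
  is_series a l -> l = l' -> is_series a l'.
Proof. now intros H <-. Qed.

Lemma is_series_asin (x : R) : -1 <= x <= 1 -> is_series (term x 0) (asin x).
Proof.
  assert (Hpos : forall y, 0 <= y <= 1 -> is_series (term y 0) (asin y)).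
  { intros y Hy.
    rewrite <- (sin_asin y) at 1 by lra.
    apply (is_series_sin 0 (fun t => t)); [easy | |].
    - intros t; auto_derive; [easy | reflexivity].
    - now apply asin_between. }
  intros Hx; destruct (Rle_dec 0 x) as [H0 | H0]; [apply Hpos; lra |].
  apply is_series_Rext with (fun k => -1 * term (- x) 0 k).
  { intros k; rewrite term_opp; simpl; ring. }
  replace (asin x) with (-1 * asin (- x)) by (rewrite asin_opp; ring).
  apply is_series_Rmult_l, Hpos; lra.
Qed.

(** The primitive of [sin] vanishing at 0 is [1 - cos t], and [cos (asin y) = sqrt (1 - y^2)];
    negative [x] follow by evenness. *)
Lemma is_series_one_minus_sqrt (x : R) :
  -1 <= x <= 1 -> is_series (term x 1) (1 - sqrt (1 - x ^ 2)).
Proof.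
  assert (Hpos : forall y, 0 <= y <= 1 ->
                 is_series (term y 1) (1 - sqrt (1 - y ^ 2))).
  { intros y Hy.
    replace (y ^ 2) with (Rsqr y) by (unfold Rsqr; ring).
    rewrite <- (cos_asin y) by lra.
    rewrite <- (sin_asin y) at 1 by lra.
    apply (is_series_sin 1 (fun t => 1 - cos t)).
    - rewrite cos_0; ring.
    - intros t; auto_derive; [easy | ring].
    - now apply asin_between. }
  intros Hx; destruct (Rle_dec 0 x) as [H0 | H0]; [apply Hpos; lra |].
  apply is_series_Rext with (term (- x) 1).
  { intros k; rewrite term_opp; simpl; ring. }
  replace (x ^ 2) with ((- x) ^ 2) by ring.
  apply Hpos; lra.
Qed.

(** * The reduction formula *)

(** By partial fractions, each term for [n + 2] combines the term of index [k + 1] for [n] with the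
    term of index [k] for exponent 1, whose sum supplies the square root. *)
Lemma is_series_term_SS (x : R) (n : nat) (l : R) :
  -1 <= x <= 1 -> is_series (term x n) l ->
  is_series (term x (S (S n)))
    (((INR n + 1) * l - x ^ (n + 1) * sqrt (1 - x ^ 2)) / (INR n + 2)).
Proof.
  intros Hx Hl; pose proof (pos_INR n).
  apply is_series_Rext with
    (fun k => (INR n + 1) / (INR n + 2) * term x n (S k)
              + x ^ (n + 1) / (INR n + 2) * term x 1 k).
  { intros k; unfold term; rewrite invsqrt_coef_S.
    replace (2 * S k + n + 1)%nat with (2 * k + (n + 1) + 2)%nat by lia.
    replace (2 * k + S (S n) + 1)%nat with (2 * k + (n + 1) + 2)%nat by lia.
    replace (2 * k + 1 + 1)%nat with (2 * k + 2)%nat by lia.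
    rewrite !(pow_add x), !plus_INR, mult_INR; simpl (INR 2); simpl (INR 1).
    pose proof (pos_INR k).
    field; repeat split; lra. }
  replace (((INR n + 1) * l - x ^ (n + 1) * sqrt (1 - x ^ 2)) / (INR n + 2)) with
    ((INR n + 1) / (INR n + 2) * (l - x ^ (n + 1) / (INR n + 1))
     + x ^ (n + 1) / (INR n + 2) * (1 - sqrt (1 - x ^ 2))) by (field; lra).
  apply (is_series_plus (V := R_NormedModule)); apply is_series_Rmult_l.
  (* The index shift drops the term [x^(n + 1) / (n + 1)] at [k = 0]; its contribution cancels the 1
     of [1 - sqrt (1 - x^2)]. *)
  - apply is_series_incr_1.
    replace (plus _ _) with l; [exact Hl |].
    unfold term; rewrite invsqrt_coef_0, plus_INR, Nat.add_0_l.
    unfold plus; simpl; field; lra.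
  - now apply is_series_one_minus_sqrt.
Qed.

(** * Closed forms by induction *)

Lemma sum_below_S (a : nat -> R) (m : nat) :
  sum_below a (S m) = sum_below a m + a m.
Proof.
  destruct m as [|m]; simpl.
  - rewrite sum_O; ring.
  - apply sum_n_RS.
Qed.

(** Induction by the reduction formula: [(2 m + 1) / (2 m + 2)] updates the prefactor, and the
    subtracted square root term, divided by the new prefactor, is the summand [j = m]. *)
Lemma is_series_term_even (x : R) (m : nat) :
  -1 <= x <= 1 ->
  is_series (term x (2 * m))
    (binom (2 * m) m / 2 ^ (2 * m + 1) *
     (2 * asin x -
      sqrt (1 - x ^ 2) *
      sum_below
        (fun j => (2 * x) ^ (2 * j + 1) / (INR (2 * j + 1) * binom (2 * j) j)) m)).
Proof.
  intros Hx; induction m as [|m IH].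
  - replace (binom (2 * 0) 0) with 1 by (unfold Binomial.C; simpl; field).
    simpl sum_below; simpl pow.
    replace (1 / (2 * 1) * _) with (asin x) by field.
    now apply is_series_asin.
  - pose proof (is_series_term_SS x (2 * m) _ Hx IH) as H.
    replace (2 * S m)%nat with (S (S (2 * m))) at 1 by lia.
    apply (is_series_eq_lim _ _ _ H).
    rewrite sum_below_S, central_binom_S.
    pose proof (central_binom_pos m); pose proof (pos_INR m).
    replace (2 * S m + 1)%nat with (2 * m + 1 + 2)%nat by lia.
    rewrite Rpow_mult_distr, (pow_add 2 (2 * m + 1) 2), plus_INR, mult_INR.
    assert (2 ^ (2 * m + 1) <> 0) by (apply pow_nonzero; lra).
    simpl (INR 2); simpl (INR 1).
    field; repeat split; lra.
Qed.

(** As in the even case, with ratio [(2 m + 2) / (2 m + 3)] and new summand [j = m + 1]; the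
    prefactor starts at 1. *)
Lemma is_series_term_odd (x : R) (m : nat) :
  -1 <= x <= 1 ->
  is_series (term x (2 * m + 1))
    (2 ^ (2 * m + 2) / (INR (2 * m + 2) * binom (2 * S m) (S m)) *
     (1 -
      sqrt (1 - x ^ 2) * sum_n (fun j => binom (2 * j) j * (x / 2) ^ (2 * j)) m)).
Proof.
  intros Hx; induction m as [|m IH].
  - rewrite sum_O.
    replace (2 * 1)%nat with 2%nat by lia.
    replace (_ * (1 - _)) with (1 - sqrt (1 - x ^ 2))
      by (unfold Binomial.C; simpl; field).
    now apply is_series_one_minus_sqrt.
  - pose proof (is_series_term_SS x (2 * m + 1) _ Hx IH) as H.
    replace (2 * S m + 1)%nat with (S (S (2 * m + 1))) by lia.
    apply (is_series_eq_lim _ _ _ H).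
    rewrite sum_n_RS, (central_binom_S (S m)).
    pose proof (central_binom_pos (S m)); pose proof (pos_INR m).
    replace (2 * m + 1 + 1)%nat with (2 * S m)%nat by lia.
    replace (2 * m + 2)%nat with (2 * S m)%nat by lia.
    replace (2 * S m + 2)%nat with (2 * S m + 1 + 1)%nat by lia.
    rewrite Rpow_div_distr, !pow_add.
    assert (2 ^ (2 * S m) <> 0) by (apply pow_nonzero; lra).
    rewrite !plus_INR, !mult_INR, !S_INR; simpl (INR 0).
    field; repeat split; lra.
Qed.

(** * Division by [x^(n + 1)] and the stated formulas *)

Lemma is_series_of_term (x : R) (n : nat) (l : R) :
  x <> 0 -> is_series (term x n) (x ^ (n + 1) * l) ->
  is_series
    (fun k => binom (2 * k) k / INR (2 * k + n + 1) * (x / 2) ^ (2 * k)) l.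
Proof.
  intros Hx H.
  assert (Hxn : x ^ (n + 1) <> 0) by now apply pow_nonzero.
  apply is_series_Rext with (fun k => / x ^ (n + 1) * term x n k).
  - intros k; unfold term, invsqrt_coef.
    replace 4 with (2 ^ 2) by ring.
    rewrite <- pow_mult, <- Nat.add_assoc, (pow_add x (2 * k)).
    rewrite Rpow_div_distr.
    assert (2 ^ (2 * k) <> 0) by (apply pow_nonzero; lra).
    assert (INR (2 * k + (n + 1)) <> 0) by (apply not_0_INR; lia).
    field; repeat split; assumption.
  - replace l with (/ x ^ (n + 1) * (x ^ (n + 1) * l)) by (field; exact Hxn).
    now apply is_series_Rmult_l.
Qed.

Theorem theorem3p2 (x : R) (hx : 0 < Rabs x <= 1) :
  (forall n : nat, Nat.Even n ->
     is_series
       (fun k : nat => binom (2 * k) k / INR (2 * k + n + 1) * (x / 2) ^ (2 * k))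
       (binom n (n / 2) / (2 * x) ^ (n + 1) *
        (2 * asin x -
         sqrt (1 - x ^ 2) *
         sum_below
           (fun j : nat =>
              (2 * x) ^ (2 * j + 1) / (INR (2 * j + 1) * binom (2 * j) j))
           (n / 2))))
  /\
  (forall n : nat, Nat.Odd n ->
     is_series
       (fun k : nat => binom (2 * k) k / INR (2 * k + n + 1) * (x / 2) ^ (2 * k))
       ((2 / x) ^ (n + 1) / (INR (n + 1) * binom (n + 1) ((n + 1) / 2)) *
        (1 -
         sqrt (1 - x ^ 2) *
         sum_n (fun j : nat => binom (2 * j) j * (x / 2) ^ (2 * j))
           ((n - 1) / 2)))).
Proof.
  assert (Hx : -1 <= x <= 1) by (apply Rabs_le_between, hx).
  assert (Hx0 : x <> 0) by (intros ->; rewrite Rabs_R0 in hx; lra).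
  split; intros n [m ->]; apply is_series_of_term; try exact Hx0.
  - replace (2 * m / 2)%nat with m by (rewrite Nat.mul_comm, Nat.div_mul; lia).
    apply (is_series_eq_lim _ _ _ (is_series_term_even x m Hx)).
    rewrite (Rpow_mult_distr 2 x (2 * m + 1)).
    assert (x ^ (2 * m + 1) <> 0) by now apply pow_nonzero.
    assert (2 ^ (2 * m + 1) <> 0) by (apply pow_nonzero; lra).
    field; split; assumption.
  - replace ((2 * m + 1 - 1) / 2)%nat with m
      by (rewrite Nat.add_sub, Nat.mul_comm, Nat.div_mul; lia).
    replace (2 * m + 1 + 1)%nat with (2 * S m)%nat by lia.
    replace (2 * S m / 2)%nat with (S m) by (rewrite Nat.mul_comm, Nat.div_mul; lia).
    apply (is_series_eq_lim _ _ _ (is_series_term_odd x m Hx)).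
    replace (2 * m + 2)%nat with (2 * S m)%nat by lia.
    rewrite (Rpow_div_distr 2 x).
    assert (x ^ (2 * S m) <> 0) by now apply pow_nonzero.
    assert (INR (2 * S m) <> 0) by (apply not_0_INR; lia).
    pose proof (central_binom_pos (S m)).
    field; repeat split; lra.
Qed.
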